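(* (i) Let $(X,\rho,\mu)$ be a space of homogeneous type, with a collection $\{\mathscr{D}^t: t=1,\dots,T\}$ of adjacent systems of dyadic cubes. Then there is a constant $C>0$ such that for each $f\in L^1_{\mathrm{loc}}(X)$ and for all $x\in X$, $$M_d^t f(x)\le C\,Mf(x)\quad\text{for each } t\in\{1,\dots,T\},\qquad\text{and}\qquad Mf(x)\le C\sum_{t=1}^T M_d^t f(x).$$ (ii) Let $(X_j,\rho_j,\mu_j)$, $j\in\{1,\dots,k\}$, be spaces of homogeneous type, each with a collection $\{\mathscr{D}^{t_j}: t_j=1,\dots,T_j\}$ of adjacent systems of dyadic cubes, and let $\widetilde X=X_1\times\cdots\times X_k$. Then there is a constant $C>0$ such that for each $f\in L^1_{\mathrm{loc}}(\widetilde X)$ and for all $x\in\widetilde X$, $$M_d^{t_1,\dots,t_k}f(x)\le C\,M_sf(x)\quad\text{for each } t_j\in\{1,\dots,T_j\},\ j\in\{1,\dots,k\},$$ and $$M_sf(x)\le C\sum_{t_1=1}^{T_1}\cdots\sum_{t_k=1}^{T_k}M_d^{t_1,\dots,t_k}f(x).$$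
   Context: **Spaces of homogeneous type.** A quasi-metric on $X$ is a map $\rho:X\times X\to[0,\infty)$ which is symmetric, vanishes exactly on the diagonal, and satisfies $\rho(x,y)\le A_0[\rho(x,z)+\rho(z,y)]$ for a constant $A_0\ge1$. Balls are $B(x,r)=\{y:\rho(x,y)<r\}$. A space of homogeneous type $(X,\rho,\mu)$ is a set with a quasi-metric $\rho$ and a nonzero Borel measure $\mu$ (balls being measurable) such that for some constant $C_\mu$, $\mu(B(x,2r))\le C_\mu\,\mu(B(x,r))<\infty$ for all $x\in X$, $r>0$. Such a space is geometrically doubling: there is $A_1\in\mathbb N$ such that every ball $B(x,r)$ is covered by at most $A_1$ balls of radius $r/2$. A set is open if with every point it contains a ball centred at that point. **Dyadic cubes.** A system of dyadic cubes with parameters $\delta\in(0,1)$, $0<c_1\le C_1<\infty$ is a countable family $\mathscr D=\bigcup_{k\in\mathbb Z}\mathscr D_k$, $\mathscr D_k=\{Q^k_\alpha:\alpha\in\mathscr A_k\}$, of Borel sets with: $X=\bigcup_\alpha Q^k_\alpha$ (disjoint union) for each $k$; if $\ell\ge k$ then either $Q^\ell_\beta\subseteq Q^k_\alpha$ or $Q^k_\alpha\cap Q^\ell_\beta=\emptyset$; for each $(k,\alpha)$ and $\ell\le k$ there is a unique $\beta$ with $Q^k_\alpha\subseteq Q^\ell_\beta$; each $Q^k_\alpha$ is the union of the cubes of $\mathscr D_{k+1}$ it contains (its children), whose number is between $1$ and a fixed constant $\mathcal M$; there are center points $x^k_\alpha\in Q^k_\alpha$ with $B(x^k_\alpha,c_1\delta^k)\subseteq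 Q^k_\alpha\subseteq B(x^k_\alpha,C_1\delta^k)=:B(Q^k_\alpha)$; and if $\ell\ge k$ and $Q^\ell_\beta\subseteq Q^k_\alpha$ then $B(Q^\ell_\beta)\subseteq B(Q^k_\alpha)$. **Adjacent systems.** A collection of adjacent systems of dyadic cubes is a finite collection $\{\mathscr D^t:t=1,\dots,T\}$ of systems of dyadic cubes with common parameters $\delta,c_1,C_1$ such that, for some constant $C\ge1$, for each ball $B(x,r)$ with $\delta^{k+3}<r\le\delta^{k+2}$, $k\in\mathbb Z$, there exist $t$ and $Q\in\mathscr D^t$ of generation $k$ with center point ${}^tx^k_\alpha$ satisfying $\rho(x,{}^tx^k_\alpha)<2A_0\delta^k$ and $B(x,r)\subseteq Q\subseteq B(x,Cr)$. Such collections always exist with $\delta<(96A_0^6)^{-1}$, $c_1=(12A_0^4)^{-1}$, $C_1=4A_0^2$, $C=8A_0^3\delta^{-3}$, and with center points satisfying $\rho({}^tx^k_\alpha,{}^tx^k_\beta)\ge(4A_0^2)^{-1}\delta^k$ for $\alpha\ne\beta$ and $\min_\alpha\rho(x,{}^tx^k_\alpha)<2A_0\delta^k$ for all $x\in X$; it is such collections that are used here. **Maximal functions.** $Mf(x)=\sup_{B\ni x}\frac1{\mu(B)}\int_B|f|\,d\mu$, the supremum over all balls $B\subset X$ containing $x$; $M_d^tf(x)$ is defined by the same formula with the supremum over dyadic cubes $Q\in\mathscr D^t$ containing $x$. On $\widetilde X$ (with the product measure $\mu_1\times\cdots\times\mu_k$), $$M_sf(x)=\sup_{B_1\times\cdots\times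 B_k\ni x}\frac1{\prod_j\mu_j(B_j)}\int_{B_1\times\cdots\times B_k}|f|\,d\mu_1\times\cdots\times d\mu_k,$$ the supremum over all products of balls $B_j\subset X_j$ containing $x$; $M_d^{t_1,\dots,t_k}f(x)$ is the same with the supremum restricted to dyadic rectangles $Q_1\times\cdots\times Q_k\in\mathscr D^{t_1}\times\cdots\times\mathscr D^{t_k}$ containing $x$. *)

(* Defs.v *)
From HB Require Import structures.
From mathcomp Require Import all_boot all_order all_algebra.
From mathcomp Require Import all_classical all_reals all_analysis.
From mathcomp Require Import measurable_realfun.

Set Implicit Arguments.
Unset Strict Implicit.
Unset Printing Implicit Defensive.

Import Order.TTheory GRing.Theory Num.Theory.
Import numFieldNormedType.Exports.

Local Open Scope classical_set_scope.
Local Open Scope ring_scope.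
Local Open Scope ereal_scope.


Definition dprod_display k : ('I_k -> measure_display) -> measure_display.
Proof. by move=> _; exact: default_measure_display. Qed.

Definition dprod k (d : 'I_k -> measure_display)
  (X : forall j, measurableType (d j)) : Type := forall j, X j.

Definition rectangle k (d : 'I_k -> measure_display)
    (X : forall j, measurableType (d j)) (A : forall j, set (X j)) :
  set (dprod X) := [set x | forall j, A j (x j)].

Section dprod_measurable.
Context k (d : 'I_k -> measure_display) (X : forall j, measurableType (d j)).

Definition dprod_sigma : set (set (dprod X)) :=
  <<s \bigcup_j
      preimage_set_system setT (fun x : dprod X => x j) measurable >>.

Let sigma0 : dprod_sigma set0.
Proof. exact: sigma_algebra0. Qed.

Let sigmaC A : dprod_sigma A -> dprod_sigma (~` A).
Proof. exact: sigma_algebraC. Qed.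

Let sigmaU (F : (set (dprod X))^nat) :
  (forall i, dprod_sigma (F i)) -> dprod_sigma (\bigcup_i F i).
Proof. exact: sigma_algebra_bigcup. Qed.

HB.instance Definition _ := gen_eqMixin (dprod X).
HB.instance Definition _ := gen_choiceMixin (dprod X).
HB.instance Definition _ := isPointed.Build (dprod X) (fun=> point).
HB.instance Definition _ :=
  @isMeasurable.Build (dprod_display d) (dprod X) dprod_sigma sigma0 sigmaC sigmaU.

Lemma measurable_dprod_proj j : measurable_fun setT (fun x : dprod X => x j).
Proof.
move=> _ B mB; apply: sub_sigma_algebra.
by exists j => //; exists B.
Qed.

Lemma measurable_rectangle (A : forall j, set (X j)) :
  (forall j, measurable (A j)) -> measurable (rectangle A).
Proof.
move=> mA.
have -> : rectangle A = \bigcap_j ((fun x : dprod X => x j) @^-1` A j).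
  by apply/seteqP; split => x /= + j; [move=> + _|move/(_ j I)]; exact.
apply: fin_bigcap_measurable => [|j _]; first exact: finite_finset.
by rewrite -[X in measurable X]setTI; exact: measurable_dprod_proj.
Qed.

Lemma measurable_dprodP d' (Y : measurableType d') (f : Y -> dprod X) :
  (forall j, measurable_fun setT (fun y => f y j)) -> measurable_fun setT f.
Proof.
move=> mf; apply: (@measurability _ _ Y (dprod X) setT f _ erefl).
move=> _ [_ [j _ [B mB <-]] <-].
by rewrite !setTI -comp_preimage -[X in measurable X]setTI; exact: mf.
Qed.

Definition update (x : dprod X) j (y : X j) : dprod X :=
  @eqtype.dfwith _ (fun i => X i : Type) x j y.

Lemma measurable_update j :
  measurable_fun setT (fun p : dprod X * X j => update p.1 p.2).
Proof.
apply: measurable_dprodP => i; have [<-|ij] := eqVneq j i.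
  by under eq_fun do rewrite /update dfwith_in; exact: measurable_snd.
under eq_fun do rewrite /update dfwith_out//.
have /= h := measurableT_comp (@measurable_dprod_proj i) (@measurable_fst _ _ (dprod X) (X j)).
exact: h.
Qed.

End dprod_measurable.

Section dprod_measure.
Context (R : realType) k (d : 'I_k -> measure_display)
  (X : forall j, measurableType (d j))
  (mu : forall j, {sigma_finite_measure set X j -> \bar R}).

Implicit Types (s : seq 'I_k) (g : dprod X -> \bar R).

Fixpoint iter_integral (s : seq 'I_k) (g : dprod X -> \bar R) (x : dprod X) :
    \bar R :=
  if s is j :: s' then
    \int[mu j]_y iter_integral s' g (update x y)
  else g x.

Lemma iter_integral_ge0 s g : (forall x, 0 <= g x) ->
  forall x, 0 <= iter_integral s g x.
Proof.
move=> g0; elim: s => [//|j s ih] x /=.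
by apply: integral_ge0 => y _; exact: ih.
Qed.

Lemma measurable_iter_integral s g : (forall x, 0 <= g x) ->
  measurable_fun setT g -> measurable_fun setT (iter_integral s g).
Proof.
move=> g0 mg; elim: s => [//|j s ih] /=.
pose f (p : dprod X * X j) := iter_integral s g (update p.1 p.2).
have f0 p : 0 <= f p by exact: iter_integral_ge0.
have mf : measurable_fun setT f.
  exact: (measurableT_comp ih (measurable_update (j := j))).
exact: (measurable_fun_fubini_tonelli_F (m2 := mu j) f mf f0).
Qed.

Lemma iter_integral_nneseries s (g : (dprod X -> \bar R)^nat) :
  (forall n x, 0 <= g n x) -> (forall n, measurable_fun setT (g n)) ->
  forall x, iter_integral s (fun x => \sum_(n <oo) g n x) x =
            \sum_(n <oo) iter_integral s (g n) x.
Proof.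
move=> g0 mg; elim: s => [//|j s ih] x /=.
under eq_integral do rewrite ih.
rewrite integral_nneseries// => [n|n y _]; last exact: iter_integral_ge0.
apply: (measurableT_comp (measurable_iter_integral s (g0 n) (mg n))).
exact: (measurableT_comp (measurable_update (j := j)) (pair1_measurable x)).
Qed.

(* The value does not depend on the base point, since every coordinate is
   integrated out; [dprod_measure_rectangle] characterizes this measure. *)
Definition dprod_measure (A : set (dprod X)) : \bar R :=
  iter_integral (enum 'I_k) (fun x => (\1_A x)%:E) point.

Let dprod_measure0 : dprod_measure set0 = 0.
Proof.
rewrite /dprod_measure; elim: (enum _) (point : dprod X) => [|j s ih] x /=.
  by rewrite indic0.
by apply: integral0_eq => y _; exact: ih.
Qed.

Let dprod_measure_ge0 A : 0 <= dprod_measure A.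
Proof. by apply: iter_integral_ge0 => x; rewrite lee_fin. Qed.

Let dprod_measure_sigma_additive : semi_sigma_additive dprod_measure.
Proof.
move=> F mF tF mUF.
have g0 n (x : dprod X) : 0 <= (\1_(F n) x)%:E :> \bar R by rewrite lee_fin.
have mg n : measurable_fun setT (fun x : dprod X => (\1_(F n) x)%:E : \bar R).
  exact/measurable_EFinP.
have -> : dprod_measure (\bigcup_n F n) = \sum_(n <oo) dprod_measure (F n).
  rewrite /dprod_measure -(iter_integral_nneseries _ g0 mg).
  have -> // : (fun x : dprod X => (\1_(\bigcup_n F n) x)%:E) =
               (fun x => \sum_(n <oo) (\1_(F n) x)%:E) :> (_ -> \bar R).
  by apply/funext => x; rewrite indic_bigcup.
apply/cvg_closeP; split; last by rewrite closeE.
by apply: is_cvg_nneseries => n _ _.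
Qed.

HB.instance Definition _ := isMeasure.Build _ _ _ dprod_measure
  dprod_measure0 dprod_measure_ge0 dprod_measure_sigma_additive.

Let iter_integral_rectangle (A : forall j, set (X j)) s x :
  (forall j, measurable (A j)) -> uniq s ->
  iter_integral s (fun x => (\1_(rectangle A) x)%:E) x =
  (\prod_(j <- s) mu j (A j)) *
  (\1_(rectangle (fun j => if j \in s then setT else A j)) x)%:E.
Proof.
move=> mA; elim: s x => [|j s ih] x; first by rewrite big_nil mul1e.
move=> /= /andP[js us]; rewrite big_cons.
pose B i := if i \in j :: s then setT else A i.
transitivity (\int[mu j]_y
    (((\prod_(i <- s) mu i (A i)) * (\1_(rectangle B) x)%:E) *
     (\1_(A j) y)%:E)).
  apply: eq_integral => y _; rewrite ih// -muleA -EFinM; congr (_ * _%:E).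
  rewrite !indicE -natrM mulnb; congr ((nat_of_bool _)%:R); apply/idP/idP.
    rewrite inE => h; apply/andP; split.
      rewrite inE => i; have := h i; rewrite /B inE.
      have [->//|ij] := eqVneq i j.
      by rewrite /update dfwith_out// eq_sym.
    by rewrite inE; have := h j; rewrite (negbTE js) /update dfwith_in.
  move=> /andP[]; rewrite !inE => h Ay i; have := h i; rewrite /B inE.
  have [->|ij] := eqVneq i j.
    by rewrite (negbTE js) /update dfwith_in.
  by rewrite /update dfwith_out// eq_sym.
have c0 : 0 <= (\prod_(i <- s) mu i (A i)) * (\1_(rectangle B) x)%:E.
  by rewrite mule_ge0// ?lee_fin// prode_ge0.
have mAj : measurable_fun setT (fun y => (\1_(A j) y)%:E : \bar R).
  exact/measurable_EFinP.
rewrite ge0_integralZl//.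
by rewrite integral_indic// setIT muleC muleA.
Qed.

Lemma dprod_measure_rectangle (A : forall j, set (X j)) :
  (forall j, measurable (A j)) ->
  dprod_measure (rectangle A) = \prod_j mu j (A j).
Proof.
move=> mA; rewrite /dprod_measure iter_integral_rectangle ?enum_uniq//.
rewrite big_enum /= [X in (\1_X _)%:E](_ : _ = setT) ?indicT ?mule1//.
by apply/seteqP; split => // x _ j /=; rewrite mem_enum.
Qed.

End dprod_measure.


Definition quasi_metric (R : realType) (T : Type) (A0 : R) (rho : T -> T -> R) :=
  [/\ (1 <= A0)%R,
      forall x y, (0 <= rho x y)%R,
      forall x y, rho x y = rho y x,
      forall x y, rho x y = 0%R <-> x = y &
      forall x y z, (rho x y <= A0 * (rho x z + rho z y))%R].

Definition qball (R : realType) (T : Type) (rho : T -> T -> R) (x : T) (r : R) :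
  set T := [set y | (rho x y < r)%R].

Definition qopen (R : realType) (T : Type) (rho : T -> T -> R) (U : set T) :=
  forall x, U x -> exists2 r : R, (0 < r)%R & qball rho x r `<=` U.

Record homogeneous_space (R : realType) := HomogeneousSpace {
  hs_display : measure_display;
  hs_carrier :> measurableType hs_display;
  hs_A0 : R;
  hs_dist : hs_carrier -> hs_carrier -> R;
  hs_measure : {measure set hs_carrier -> \bar R};
  hs_quasi_metric : quasi_metric hs_A0 hs_dist;
  hs_measurable_open : forall U, qopen hs_dist U -> measurable U;
  hs_measurable_ball : forall x r, measurable (qball hs_dist x r);
  hs_neq0 : hs_measure setT != 0;
  hs_doubling : exists C : R, forall x r, (0 < r)%R ->
    hs_measure (qball hs_dist x (2 * r)) <=
      C%:E * hs_measure (qball hs_dist x r) < +oo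
}.

Section homogeneous.
Context (R : realType) (X : homogeneous_space R).

Definition hs_ball (x : X) (r : R) : set X := qball (@hs_dist R X) x r.

(* An alias of [hs_measure], to carry the sigma-finite structure. *)
Definition hs_mu : set X -> \bar R := hs_measure X.

HB.instance Definition _ := Measure.on hs_mu.

Let hs_mu_ball_lty x r : (0 < r)%R -> hs_mu (hs_ball x r) < +oo.
Proof.
move=> r0; have [C hC] := hs_doubling X.
have r20 : (0 < r / 2)%R by rewrite divr_gt0.
have /andP[h1 h2] := hC x _ r20; have := le_lt_trans h1 h2.
by rewrite mulrC divfK.
Qed.

Let hs_mu_sigma_finite : sigma_finite setT hs_mu.
Proof.
exists (fun n => hs_ball point n.+1%:R) => [|n].
  apply/seteqP; split => // x _; exists (Num.truncn (hs_dist point x)) => //=.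
  by rewrite /hs_ball /qball /= Num.Theory.truncnS_gt.
by split; [exact: hs_measurable_ball|exact: hs_mu_ball_lty].
Qed.

HB.instance Definition _ :=
  Measure_isSigmaFinite.Build _ _ _ hs_mu hs_mu_sigma_finite.

Definition balls : set (set X) :=
  [set B | exists x r, (0 < r)%R /\ B = hs_ball x r].

(* Local integrability in the topological sense; in particular it holds if
   [f] is integrable on every ball. *)
Definition L1loc (f : X -> R) := measurable_fun setT f /\
  forall x, exists2 r : R, (0 < r)%R &
    hs_mu.-integrable (hs_ball x r) (EFin \o f).

Definition maximal (F : set (set X)) (f : X -> R) (x : X) : \bar R :=
  ereal_sup [set (hs_mu A)^-1 * \int[hs_mu]_(y in A) `|(f y)%:E|
            | A in [set A | F A /\ A x]].

Definition HLmaximal := maximal balls.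

End homogeneous.


Record cube_family (T : Type) := CubeFamily {
  cube_index : int -> countType;
  cube : forall k, cube_index k -> set T;
  center : forall k, cube_index k -> T
}.

Definition cubes (T : Type) (D : cube_family T) : set (set T) :=
  [set Q | exists k (a : cube_index D k), Q = cube a].

Section dyadic.
Context (R : realType) (X : homogeneous_space R).
Local Notation rho := (@hs_dist R X).
Local Notation A0 := (hs_A0 X).

Definition cube_ball (C1 delta : R) (D : cube_family X) k (a : cube_index D k) :
  set X := hs_ball (center a) (C1 * delta ^ k)%R.

Definition children (D : cube_family X) k (a : cube_index D k) :
  set (cube_index D (k + 1)%R) := [set b | cube b `<=` cube a].

Record dyadic_system (delta c1 C1 : R) (D : cube_family X) : Prop := {
  dyadic_delta : (0 < delta < 1)%R;
  dyadic_const : (0 < c1 <= C1)%R;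
  dyadic_borel : forall k (a : cube_index D k), <<s qopen rho >> (cube a);
  dyadic_cover : forall k, \bigcup_(a : cube_index D k) cube a = setT;
  dyadic_disjoint : forall k,
    trivIset setT (fun a : cube_index D k => cube a);
  dyadic_nested : forall k l (a : cube_index D k) (b : cube_index D l),
    (k <= l)%R -> cube b `<=` cube a \/ cube a `&` cube b = set0;
  dyadic_ancestor : forall k l (a : cube_index D k), (l <= k)%R ->
    exists! b : cube_index D l, cube a `<=` cube b;
  dyadic_children : forall k (a : cube_index D k),
    cube a = \bigcup_(b in children a) cube b;
  dyadic_card_children : exists M : nat, forall k (a : cube_index D k),
    children a !=set0 /\ (children a #<= `I_M)%card;
  dyadic_center : forall k (a : cube_index D k), cube a (center a);
  dyadic_ball : forall k (a : cube_index D k),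
    hs_ball (center a) (c1 * delta ^ k)%R `<=` cube a /\
    cube a `<=` cube_ball C1 delta a;
  dyadic_ball_nested : forall k l (a : cube_index D k) (b : cube_index D l),
    (k <= l)%R -> cube b `<=` cube a ->
    cube_ball C1 delta b `<=` cube_ball C1 delta a
}.

Definition adjacent_systems (delta c1 C1 C : R) (T : nat)
    (D : 'I_T -> cube_family X) :=
  [/\ forall t, dyadic_system delta c1 C1 (D t),
      (1 <= C)%R &
      forall x r (k : int), (delta ^ (k + 3) < r <= delta ^ (k + 2))%R ->
        exists t (a : cube_index (D t) k),
          [/\ (rho x (center a) < 2 * A0 * delta ^ k)%R,
              hs_ball x r `<=` cube a &
              cube a `<=` hs_ball x (C * r)]].

(* Adjacent systems with the normalization of the constants for which their
   existence is known. *)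
Definition adjacent_dyadic_systems (T : nat) (D : 'I_T -> cube_family X) :=
  exists delta : R,
    [/\ (0 < delta < (96 * A0 ^+ 6)^-1)%R,
        adjacent_systems delta (12 * A0 ^+ 4)^-1 (4 * A0 ^+ 2)
          (8 * A0 ^+ 3 * delta ^- 3) D,
        forall t k (a b : cube_index (D t) k), a != b ->
          ((4 * A0 ^+ 2)^-1 * delta ^ k <= rho (center a) (center b))%R &
        forall t k x, exists a : cube_index (D t) k,
          (rho x (center a) < 2 * A0 * delta ^ k)%R].

Definition dyadic_maximal (D : cube_family X) := maximal (cubes D).

End dyadic.


Section product.
Context (R : realType) (k : nat) (X : 'I_k -> homogeneous_space R).

Definition prod_space := dprod (fun j => hs_carrier (X j)).

Definition prod_mu : {measure set prod_space -> \bar R} :=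
  dprod_measure (fun j => @hs_mu R (X j)).

Definition prod_L1loc (f : prod_space -> R) := measurable_fun setT f /\
  forall x : prod_space, exists2 r : R, (0 < r)%R &
    prod_mu.-integrable (rectangle (fun j => hs_ball (x j) r)) (EFin \o f).

Definition prod_maximal (F : forall j, set (set (X j))) (f : prod_space -> R)
    (x : prod_space) : \bar R :=
  ereal_sup [set (\prod_j hs_mu (A j))^-1 *
                 \int[prod_mu]_(y in rectangle A) `|(f y)%:E|
            | A in [set A : forall j, set (X j) |
                    forall j, F j (A j) /\ A j (x j)]].

Definition strong_maximal := prod_maximal (fun j => @balls R (X j)).

Definition prod_dyadic_maximal (D : forall j, cube_family (X j)) :=
  prod_maximal (fun j => cubes (D j)).

End product.

(* Main.v *)
Require Import Defs.
From HB Require Import structures.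
From mathcomp Require Import all_boot all_order all_algebra.
From mathcomp Require Import all_classical all_reals all_analysis.
From mathcomp Require Import measurable_realfun.

(** Every dyadic cube lies in a ball, and by adjacency every ball lies in a cube
    of one of the systems, where in both cases the larger set is contained in a
    fixed dilate of a ball inside the smaller one.  By doubling the measures of
    the two sets are then comparable, so enlarging the set increases an average
    of [|f|] by no more than a constant factor.  On products this is done in each
    coordinate and the constants multiply. *)

Set Implicit Arguments.
Unset Strict Implicit.
Unset Printing Implicit Defensive.

Import Order.TTheory GRing.Theory Num.Theory.

Local Open Scope classical_set_scope.
Local Open Scope ring_scope.
Local Open Scope ereal_scope.

(** This picks the generation at which adjacency applies to a ball of radius [r]. The exponent is
    the integer part of the logarithm of [r] to base [delta]; as [ln delta] is negative, dividing by
    it reverses the inequalities. *)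
Lemma exprz_bracket (R : realType) (delta r : R) :
  (0 < delta < 1)%R -> (0 < r)%R ->
  exists m : int, (delta ^ (m + 1) < r <= delta ^ m)%R.
Proof.
move=> /andP[d0 d1] r0.
have lnd : (ln delta < 0)%R by rewrite ln_lt0// d0 d1.
have expE (m : int) : (delta ^ m = expR (m%:~R * ln delta))%R.
  by rewrite -powR_intmul ?ltW// /powR gt_eqF.
exists (Num.floor (ln r / ln delta)); rewrite !expE -[r in (_ < r <= _)%R]lnK//.
by rewrite ltr_expR ler_expR -ltr_ndivrMr// -ler_ndivlMr//
  floor_le_tmp floorD1_gt.
Qed.

(** * Doubling and sets of comparable measure *)

Section homogeneous_measure.
Context (R : realType) (X : homogeneous_space R).
Local Notation rho := (@hs_dist R X).
Local Notation mu := (@hs_mu R X).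

Lemma measurable_hs_ball (x : X) r : measurable (hs_ball x r).
Proof. exact: hs_measurable_ball. Qed.

Lemma le_hs_ball (x : X) r s : (r <= s)%R -> hs_ball x r `<=` hs_ball x s.
Proof. by move=> rs y; rewrite /hs_ball /qball /= => /lt_le_trans; apply. Qed.

Lemma hs_mu_ball_doubling : exists2 c : R, (0 <= c)%R &
  forall (x : X) n r, (0 < r)%R ->
    mu (hs_ball x (2 ^+ n * r)) <= (c ^+ n)%:E * mu (hs_ball x r).
Proof.
have [C hC] := hs_doubling X.
(* The absolute value makes the constant nonnegative, so that the induction can multiply
   inequalities by it. *)
exists `|C|%R => // x n r r0; elim: n => [|n ih]; first by rewrite mul1r mul1e.
have /(hC x)/andP[h _] : (0 < 2 ^+ n * r)%R by rewrite mulr_gt0// exprn_gt0.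
rewrite exprS -mulrA; apply: (le_trans h).
apply: (@le_trans _ _ (`|C|%:E * mu (hs_ball x (2 ^+ n * r)))).
  by apply: lee_wpmul2r => //; rewrite lee_fin ler_norm.
by rewrite exprS EFinM -muleA; apply: lee_wpmul2l.
Qed.

Lemma hs_mu_ball_lty (x : X) r : mu (hs_ball x r) < +oo.
Proof.
have [C hC] := hs_doubling X.
have [r0|r0] := ltP 0%R r.
  have /(hC x)/andP[h1 h2] : (0 < r / 2)%R by rewrite divr_gt0.
  by have := le_lt_trans h1 h2; rewrite mulrC divfK.
(* A ball of nonpositive radius lies in the one of radius 2, to which doubling applies. *)
apply: (@le_lt_trans _ _ (mu (hs_ball x (2 * 1)))).
  apply: le_measure; rewrite ?inE; try exact: measurable_hs_ball.
  by apply: le_hs_ball; rewrite (le_trans r0).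
by have /andP[h1 h2] := hC x 1%R ltr01; exact: le_lt_trans h1 h2.
Qed.

(* A null ball would have only null dilates, and these exhaust the space. *)
Lemma hs_mu_ball_gt0 (x : X) r : (0 < r)%R -> 0 < mu (hs_ball x r).
Proof.
move=> r0; rewrite lt_neqAle measure_ge0 andbT eq_sym.
apply/negP => /eqP B0; have [c c0 hc] := hs_mu_ball_doubling.
have /eqP[] := hs_neq0 X.
apply: (measure_negligible (mu := hs_measure X)) => //.
have -> : setT = \bigcup_n hs_ball x (2 ^+ n * r).
  apply/seteqP; split=> // y _; exists (Num.truncn (rho x y / r)) => //.
  rewrite /hs_ball /qball /= -ltr_pdivrMr//.
  apply: (lt_le_trans (truncnS_gt _)).
  by rewrite -natrX ler_nat ltn_expl.
apply: negligible_bigcup => n; apply/negligibleP.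
  exact: measurable_hs_ball.
apply/eqP; rewrite eq_le measure_ge0 andbT.
by apply: (le_trans (hc x n r r0)); rewrite B0 mule0.
Qed.

(** The strict bounds on the measures keep both inverses in the averages away from their
    conventional values at [0] and [+oo]. *)
Definition dominates (c : R) (A B : set X) :=
  [/\ measurable A, measurable B & A `<=` B] /\
  [/\ 0 < mu A, mu B < +oo & mu B <= c%:E * mu A].

(** About log2 of [l] doublings carry the inner ball past the outer one. The constant is fixed
    before the sets and the radii, hence is uniform over all generations. *)
Lemma dominates_sandwich (l : R) : exists2 c : R, (0 < c)%R &
  forall (x : X) (r s : R) (A B : set X), measurable A -> measurable B ->
    (0 < r)%R -> (s <= l * r)%R ->
    hs_ball x r `<=` A -> A `<=` B -> B `<=` hs_ball x s -> dominates c A B.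
Proof.
have [c c0 hc] := hs_mu_ball_doubling.
pose n := (Num.truncn l).+1.
(* Here [l < n < 2 ^+ n]; the summand 1 ensures positivity, since only [0 <= c] is known. *)
exists (c ^+ n + 1)%R => [|x r s A B mA mB r0 slr rA AB Bs].
  by rewrite ltr_wpDl// exprn_ge0.
have muBA : mu B <= (c ^+ n + 1)%:E * mu A.
  apply: (@le_trans _ _ (mu (hs_ball x (2 ^+ n * r)))).
    apply: le_measure; rewrite ?inE//; first exact: measurable_hs_ball.
    apply: (subset_trans Bs); apply: le_hs_ball; apply: (le_trans slr).
    rewrite ler_pM2r// ltW//; apply: (lt_le_trans (truncnS_gt _)).
    by rewrite -natrX ler_nat ltnW// ltn_expl.
  apply: (le_trans (hc x n r r0)); apply: lee_pmul => //.
  - by rewrite lee_fin exprn_ge0.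
  - by rewrite lee_fin lerDl.
  - by apply: le_measure; rewrite ?inE//; exact: measurable_hs_ball.
split=> //; split=> //.
  apply: (lt_le_trans (hs_mu_ball_gt0 x r0)).
  by apply: le_measure; rewrite ?inE//; exact: measurable_hs_ball.
apply: le_lt_trans (hs_mu_ball_lty x s).
by apply: le_measure; rewrite ?inE//; exact: measurable_hs_ball.
Qed.

Lemma measurable_balls B : @balls R X B -> measurable B.
Proof. by move=> [x [r [_ ->]]]; exact: measurable_hs_ball. Qed.

Lemma measurable_cubes (delta c1 C1 : R) (D : cube_family X) Q :
  dyadic_system delta c1 C1 D -> cubes D Q -> measurable Q.
Proof.
move=> DD [k [a ->]]; have := dyadic_borel DD a.
apply: smallest_sub; first exact: sigma_algebra_measurable.
exact: hs_measurable_open.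
Qed.

Lemma dominatesW (c c' : R) A B :
  (c <= c')%R -> dominates c A B -> dominates c' A B.
Proof.
move=> cc' [AB [A0 Boo BA]]; split=> //; split=> //; apply: (le_trans BA).
by apply: lee_wpmul2r; [exact: ltW|rewrite lee_fin].
Qed.

(** The inner and outer balls of a cube are concentric and the ratio [C1 / c1] of their radii is the
    same in every generation. *)
Lemma cube_dominated (delta c1 C1 : R) : exists2 c : R, (0 < c)%R &
  forall D : cube_family X, dyadic_system delta c1 C1 D ->
    forall Q, cubes D Q -> exists2 B, balls B & dominates c Q B.
Proof.
have [c c0 hc] := dominates_sandwich (C1 / c1).
exists c => // D DD _ [k [a ->]]; have /andP[c10 c1C1] := dyadic_const DD.
have /andP[d0 _] := dyadic_delta DD.
have dk : (0 < delta ^ k)%R by rewrite exprz_gt0.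
have C10 := lt_le_trans c10 c1C1.
have [rQ Qs] := dyadic_ball DD a.
have bB : balls (cube_ball C1 delta a).
  by exists (Defs.center a), (C1 * delta ^ k)%R; rewrite mulr_gt0.
exists (cube_ball C1 delta a) => //.
apply: (hc _ _ _ _ _ _ _ _ _ rQ Qs) => //.
- by apply: measurable_cubes DD _; exists k, a.
- exact: measurable_balls.
- by rewrite mulr_gt0.
- by rewrite mulrA divfK// gt_eqF.
Qed.

Lemma ball_dominated (delta c1 C1 C : R) T (D : 'I_T -> cube_family X) :
  (0 < delta < 1)%R -> adjacent_systems delta c1 C1 C D ->
  exists2 c : R, (0 < c)%R & forall B, balls B ->
    exists t, exists2 Q, cubes (D t) Q & dominates c B Q.
Proof.
move=> d01 [DD _ adj].
have [c c0 hc] := dominates_sandwich C.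
exists c => // _ [x [r [r0 ->]]].
have [m hm] := exprz_bracket d01 r0.
(* Generation [m - 2] turns the bracket with exponents [m + 1] and [m] into the one with [k + 3] and
   [k + 2] that adjacency asks for. *)
have [|t [a [_ BQ Qs]]] := adj x r (m - 2)%R.
  by rewrite subrK -addrA (_ : (- 2 + 3 = 1 :> int)%R).
have cQ : cubes (D t) (cube a) by exists (m - 2)%R, a.
exists t, (cube a) => //.
apply: (hc x r _ _ _ _ _ _ _ _ BQ Qs) => //; first exact: measurable_hs_ball.
exact: measurable_cubes (DD t) cQ.
Qed.

Lemma adjacent_dominated T (D : 'I_T -> cube_family X) :
  adjacent_dyadic_systems D ->
  exists2 c : R, (0 < c)%R &
    (forall t Q, cubes (D t) Q -> exists2 B, balls B & dominates c Q B) /\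
    (forall B, balls B -> exists t, exists2 Q, cubes (D t) Q & dominates c B Q).
Proof.
move=> [delta [/andP[d0 d1] adj _ _]].
have d01 : (0 < delta < 1)%R.
  have [A01 _ _ _ _] := hs_quasi_metric X.
  have A00 : (0 < hs_A0 X)%R by exact: lt_le_trans A01.
  (* Since [A0 >= 1], also [96 * A0 ^+ 6 >= 1], so its inverse is at most 1. *)
  rewrite d0 (lt_le_trans d1)// invf_le1 ?mulr_gt0 ?exprn_gt0//.
  by rewrite -[leLHS]mulr1 ler_pM// ?exprn_ege1// ler1n.
have [c c0 hc] := ball_dominated d01 adj; have [DD _ _] := adj.
have [c' c'0 hc'] :=
  cube_dominated delta (12 * hs_A0 X ^+ 4)^-1 (4 * hs_A0 X ^+ 2).
exists (c + c')%R; first by rewrite addr_gt0.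
split=> [t Q DQ|B /hc[t [Q DQ BQ]]].
- have [B bB QB] := hc' _ (DD t) _ DQ; exists B => //.
  by apply: dominatesW QB; rewrite lerDr ltW.
- by exists t, Q => //; apply: dominatesW BQ; rewrite lerDl ltW.
Qed.

End homogeneous_measure.

(** * Averages over comparable sets *)

Section averages.
Context (R : realType).

(** The normalizations [a] and [b] are not tied to [m A] and [m B], so that on products they can be
    the products of the measures of the sides, as in the definition of [prod_maximal]. *)
Lemma le_average d (T : measurableType d) (m : {measure set T -> \bar R})
    (f : T -> R) (A B : set T) (a b : \bar R) (c : R) :
  measurable_fun setT f -> measurable A -> measurable B -> A `<=` B ->
  0 < a -> a <= b -> b < +oo -> b <= c%:E * a ->
  a^-1 * \int[m]_(y in A) `|(f y)%:E| <=
    c%:E * (b^-1 * \int[m]_(y in B) `|(f y)%:E|).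
Proof.
move=> mf mA mB AB a0 ab boo bca.
have b0 := lt_le_trans a0 ab.
have bfin : b \is a fin_num by rewrite ge0_fin_numE// ltW.
have afin : a \is a fin_num by rewrite ge0_fin_numE ?ltW// (le_lt_trans ab).
rewrite muleA; apply: lee_pmul.
- by rewrite inve_ge0 ltW.
- by apply: integral_ge0.
- move: a b a0 b0 afin bfin bca {ab boo} => [a| |] [b| |]// a0 b0 _ _.
  rewrite -EFinM !inver !gt_eqF// -EFinM !lee_fin => bca.
  by rewrite ler_pdivlMr// mulrC ler_pdivrMr.
- apply: ge0_subset_integral => //; apply/measurable_EFinP.
  by apply: measurableT_comp => //; exact: measurable_funTS.
Qed.

(** Leaving [G] arbitrary serves both inequalities: it is the balls in one and the cubes of a system
    in the other. *)
Lemma average_le_maximal (X : homogeneous_space R) (c : R) (f : X -> R)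
    (G : set (set X)) (A B : set X) x :
  (0 < c)%R -> measurable_fun setT f -> A x -> G B -> dominates c A B ->
  (hs_mu A)^-1 * \int[@hs_mu R X]_(y in A) `|(f y)%:E| <=
    c%:E * maximal G f x.
Proof.
move=> c0 mf Ax GB [[mA mB AB] [A0 Boo BA]].
apply: (@le_trans _ _ (c%:E *
    ((hs_mu B)^-1 * \int[@hs_mu R X]_(y in B) `|(f y)%:E|))).
  apply: le_average => //.
  by apply: le_measure; rewrite ?inE.
apply: lee_wpmul2l; first by rewrite lee_fin ltW.
by apply: ereal_sup_ubound; exists B => //; split=> //; exact: AB.
Qed.

(** The witness [B] matters: the supremum of the empty set is [-oo]. *)
Lemma maximal_ge0 (X : homogeneous_space R) (f : X -> R) (G : set (set X)) B x :
  G B -> B x -> 0 <= maximal G f x.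
Proof.
move=> GB Bx.
apply: (@le_trans _ _ ((hs_mu B)^-1 *
    \int[@hs_mu R X]_(y in B) `|(f y)%:E|)).
  by rewrite mule_ge0 ?inve_ge0// integral_ge0.
by apply: ereal_sup_ubound; exists B.
Qed.

Lemma prod_average_le_maximal k (X : 'I_k -> homogeneous_space R)
    (c : 'I_k -> R) (f : prod_space X -> R) (G : forall j, set (set (X j)))
    (A B : forall j, set (X j)) (x : prod_space X) :
  (forall j, 0 < c j)%R -> measurable_fun setT f -> (forall j, A j (x j)) ->
  (forall j, G j (B j)) -> (forall j, dominates (c j) (A j) (B j)) ->
  (\prod_j hs_mu (A j))^-1 * \int[prod_mu X]_(y in rectangle A) `|(f y)%:E| <=
    (\prod_j c j)%:E * prod_maximal G f x.
Proof.
move=> c0 mf Ax GB dom.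
have A0 j : 0 < hs_mu (A j) by have [_ []] := dom j.
have AB j : hs_mu (A j) <= hs_mu (B j).
  by have [[? ? ?] _] := dom j; apply: le_measure; rewrite ?inE.
have le_prod (u v : 'I_k -> \bar R) : (forall j, 0 <= u j <= v j) ->
    \prod_j u j <= \prod_j v j.
  (* Nonnegativity is carried through the induction because multiplying inequalities requires it. *)
  move=> uv; suff /andP[] : 0 <= \prod_j u j <= \prod_j v j by [].
  apply: (big_ind2 (fun a b => 0 <= a <= b)) => [|a b a' b'|j _].
  - by rewrite lee01 lexx.
  - by move=> /andP[? ?] /andP[? ?]; rewrite mule_ge0//= lee_pmul.
  - exact: uv.
apply: (@le_trans _ _ ((\prod_j c j)%:E * ((\prod_j hs_mu (B j))^-1 *
    \int[prod_mu X]_(y in rectangle B) `|(f y)%:E|))).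
  apply: le_average => //.
  - by apply: measurable_rectangle => j; have [[]] := dom j.
  - by apply: measurable_rectangle => j; have [[]] := dom j.
  - by move=> y Ay j; have [[_ _ AjBj] _] := dom j; exact: AjBj.
  - by apply: (big_ind (fun a => 0 < a)) => // *; exact: mule_gt0.
  - by apply: le_prod => j; rewrite AB ltW.
  - rewrite ltey_eq prode_fin_num// => j _.
    by rewrite ge0_fin_numE//; have [_ []] := dom j.
  - rewrite -prodEFin -big_split /=; apply: le_prod => j.
    by rewrite measure_ge0; have [_ []] := dom j.
apply: lee_wpmul2l; first by rewrite lee_fin ltW// prodr_gt0.
apply: ereal_sup_ubound; exists B => // j.
by split=> //; have [[_ _ AjBj] _] := dom j; exact: AjBj.
Qed.

Lemma prod_maximal_ge0 k (X : 'I_k -> homogeneous_space R)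
    (f : prod_space X -> R) (G : forall j, set (set (X j)))
    (B : forall j, set (X j)) (x : prod_space X) :
  (forall j, G j (B j)) -> (forall j, B j (x j)) -> 0 <= prod_maximal G f x.
Proof.
move=> GB Bx; apply: (@le_trans _ _ ((\prod_j hs_mu (B j))^-1 *
    \int[prod_mu X]_(y in rectangle B) `|(f y)%:E|)).
  by rewrite mule_ge0 ?inve_ge0 ?prode_ge0// integral_ge0.
by apply: ereal_sup_ubound; exists B.
Qed.

End averages.

(** Generation 0 already covers; this supplies the witness that makes each dyadic maximal function
    nonnegative. *)
Lemma cubes_cover (R : realType) (X : homogeneous_space R) (delta c1 C1 : R)
    (D : cube_family X) (x : X) :
  dyadic_system delta c1 C1 D -> exists2 Q, cubes D Q & Q x.
Proof.
move=> DD.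
have : \bigcup_(a : cube_index D 0) cube a = setT by apply: dyadic_cover DD _.
by move=> /seteqP[_ /(_ x I)][a _ ax]; exists (cube a) => //; exists 0%R, a.
Qed.

Theorem theorem3p1 (R : realType) :
  (forall (X : homogeneous_space R) (T : nat) (D : 'I_T -> cube_family X),
    adjacent_dyadic_systems D ->
    exists C : R, (0 < C)%R /\
      forall f : X -> R, L1loc f -> forall x : X,
        (forall t : 'I_T,
          dyadic_maximal (D t) f x <= C%:E * HLmaximal f x) /\
        HLmaximal f x <= C%:E * \sum_(t < T) dyadic_maximal (D t) f x) /\
  (forall (k : nat) (X : 'I_k -> homogeneous_space R) (T : 'I_k -> nat)
      (D : forall j, 'I_(T j) -> cube_family (X j)),
    (forall j, adjacent_dyadic_systems (D j)) ->
    exists C : R, (0 < C)%R /\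
      forall f : prod_space X -> R, prod_L1loc f -> forall x : prod_space X,
        (forall t : {dffun forall j : 'I_k, 'I_(T j)},
          prod_dyadic_maximal (fun j => D j (t j)) f x <=
            C%:E * strong_maximal f x) /\
        strong_maximal f x <=
          C%:E * \sum_(t : {dffun forall j : 'I_k, 'I_(T j)})
                   prod_dyadic_maximal (fun j => D j (t j)) f x).
Proof.
split=> [X T D adj|k X T D adj].
  have [c c0 [hQ hB]] := adjacent_dominated adj.
  have [delta [_ [DD _ _] _ _]] := adj.
  exists c; split=> // f [mf _] x; split=> [t|].
    apply: ge_ereal_sup => _ [Q [DQ Qx] <-].
    by have [B bB QB] := hQ _ _ DQ; exact: average_le_maximal QB.
  apply: ge_ereal_sup => _ [B [bB Bx] <-].
  have [t [Q DQ BQ]] := hB _ bB.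
  apply: (le_trans (average_le_maximal c0 mf Bx DQ BQ)).
  apply: lee_wpmul2l; first by rewrite lee_fin ltW.
  (* The system [t] found for [B] gives one term of the sum, and the others are nonnegative. *)
  rewrite (bigD1 t)//=; apply: leeDl; apply: sume_ge0 => s _.
  by have [Q' DQ' Q'x] := cubes_cover x (DD s); exact: maximal_ge0 DQ' Q'x.
have /choice[c hc] j : exists c : R, (0 < c)%R /\
    (forall t Q, cubes (D j t) Q -> exists2 B, balls B & dominates c Q B) /\
    (forall B, balls B -> exists t, exists2 Q, cubes (D j t) Q & dominates c B Q).
  by have [c] := adjacent_dominated (adj j); exists c.
have c0 j : (0 < c j)%R by have [] := hc j.
exists (\prod_j c j)%R; split=> [|f [mf _] x]; first by apply: prodr_gt0.
split=> [t|].
  apply: ge_ereal_sup => _ [Q DQ <-].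
  have hB j : exists B, balls B /\ dominates (c j) (Q j) B.
    have [_ [hQ _]] := hc j; have [DQj _] := DQ j.
    by have [B] := hQ _ _ DQj; exists B.
  apply: (prod_average_le_maximal (B := fun j => sval (cid (hB j)))) => // j.
  - by have [] := DQ j.
  - by case: cid => B [].
  - by case: cid => B [].
apply: ge_ereal_sup => _ [B bB <-].
have hQ j : exists tQ : 'I_(T j) * set (X j),
    cubes (D j tQ.1) tQ.2 /\ dominates (c j) (B j) tQ.2.
  have [_ [_ hB]] := hc j; have [bBj _] := bB j.
  by have [t [Q]] := hB _ bBj; exists (t, Q).
(* The systems chosen coordinatewise form a single index of the multiple sum, which is written as
   one sum over dependent finite functions. *)
pose t : {dffun forall j, 'I_(T j)} := [ffun j => (sval (cid (hQ j))).1].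
pose Q j := (sval (cid (hQ j))).2.
apply: (@le_trans _ _ ((\prod_j c j)%:E *
    prod_dyadic_maximal (fun j => D j (t j)) f x)).
  apply: (@prod_average_le_maximal _ _ _ _ _ _ _ Q) => // j.
  - by have [] := bB j.
  - by rewrite ffunE /Q; case: cid => tQ [].
  - by rewrite /Q; case: cid => tQ [].
apply: lee_wpmul2l; first by rewrite lee_fin ltW// prodr_gt0.
rewrite (bigD1 t)//=; apply: leeDl; apply: sume_ge0 => s _.
have hx j : exists Q', cubes (D j (s j)) Q' /\ Q' (x j).
  have [delta [_ [DD _ _] _ _]] := adj j.
  by have [Q'] := cubes_cover (x j) (DD (s j)); exists Q'.
apply: (@prod_maximal_ge0 _ _ _ _ _ (fun j => sval (cid (hx j)))) => j.
- by case: cid => Q' [].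
- by case: cid => Q' [].
Qed.
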